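(* Let $(X,\mathcal{U})$ be a sequentially complete separated uniform space, $Y$ a locally convex space quasi ordered by a nontrivial convex cone $D$, $H\subset D\setminus\{0\}$ a convex set, $f:X\to 2^Y\setminus\{\emptyset\}$ a set-valued map and $p:X\times X\to[0,+\infty)$ an r-distance. For $x\in X$ put $S(x):=\{z\in X: f(x)\subset f(z)+p(x,z)H+D\}$. Let $x_0\in X$ be such that $S(x_0)\neq\emptyset$ and such that for any $x\in S(x_0)$, $S(x)$ is dynamically closed. Suppose that the following assumptions are satisfied: (B1) $H^{+s}\cap D^+\neq\emptyset$, or equivalently, $0\notin\mathrm{cl}(H+D)$. (B2) There exists $\xi\in H^{+s}\cap D^+$ such that $\xi$ is lower bounded on $f(S(x_0))$. Then there exists $\hat{x}\in X$ such that (a) $f(x_0)\subset f(\hat{x})+p(x_0,\hat{x})H+D$; (b) for all $x\in X\setminus\{\hat{x}\}$, $f(\hat{x})\not\subset f(x)+p(\hat{x},x)H+D$. If $p(x,x)=0$ for all $x\in X$, then $\hat{x}$ is a strict minimizer of $f(\cdot)+p(\hat{x},\cdot)H$.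
   Context: Locally convex space means real locally convex Hausdorff topological vector space. A convex cone $D\subset Y$ is a nonempty set with $D+D\subset D$ and $\alpha D\subset D$ for all $\alpha\ge0$; nontrivial means $D\ne\{0\}$, $D\neq Y$; it induces the quasi order $y_1\le_D y_2\iff y_2-y_1\in D$. Sums of sets are Minkowski sums and $f(A):=\bigcup_{x\in A}f(x)$. $Y^*$ is the topological dual, $D^+:=\{l\in Y^*: l(d)\ge0\ \forall d\in D\}$, $H^{+s}:=\{l\in Y^*:\inf_{h\in H}l(h)>0\}$. $\xi$ is lower bounded on $M\subset Y$ if $\inf_{y\in M}\xi(y)>-\infty$. r-distance: for a separated (Hausdorff) uniform space $X$, a function $p:X\times X\to[0,+\infty]$ is an r-distance on $X$ if (q1) $p(x,z)\le p(x,y)+p(y,z)$ for all $x,y,z\in X$; (q2$''$) every sequence $(y_n)\subset X$ with $p(y_n,y_m)\to0$ as $m>n\to\infty$ (i.e. for every $\delta>0$ there is $N$ with $p(y_n,y_m)<\delta$ for all $m>n\ge N$) is a Cauchy sequence in $X$; (q3) for $x,y,z\in X$, $p(z,x)=0$ and $p(z,y)=0$ imply $x=y$. $S(x)$ is dynamically closed if, whenever $(x_n)\subset S(x)$ satisfies $S(x_{n+1})\subset S(x_n)\subset S(x)$ for all $n$ and $x_n\to\bar{x}$ in $X$, then $\bar{x}\in S(x)$. A point $\hat{x}$ is a strict minimizer of a set-valued map $G:X\to2^Y$ (with respect to $D$) if $G(\hat{x})\not\subset G(x)+D$ for every $x\in X\setminus\{\hat{x}\}$. *)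

(* Defs.v *)
From HB Require Import structures.
From mathcomp Require Import all_boot all_order all_algebra.
From mathcomp Require Import all_classical all_reals all_analysis.

Set Implicit Arguments.
Unset Strict Implicit.
Unset Printing Implicit Defensive.

Import Order.TTheory GRing.Theory Num.Theory.
Import numFieldNormedType.Exports.

Local Open Scope classical_set_scope.
Local Open Scope ring_scope.

Definition minkowski_sum (V : zmodType) (A B : set V) : set V :=
  [set a + b | a in A & b in B].

Definition set_scale (R : pzRingType) (V : lmodType R) (r : R) (A : set V) :
  set V := [set r *: a | a in A].

Notation "A `(+)` B" := (minkowski_sum A B)
  (at level 50, left associativity) : classical_set_scope.
Notation "r `*:` A" := (set_scale r A)
  (at level 40, left associativity) : classical_set_scope.

Definition sequentially_complete (X : uniformType) : Prop :=
  forall u : nat -> X, cauchy (u n @[n --> \oo]) ->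
    exists l : X, u n @[n --> \oo] --> l.

Section RDistance.
Context {R : realType} {X : uniformType}.

(* The second clause expresses "p(y_n, y_m) -> 0 as m > n -> oo implies
   that (y_n) is Cauchy". *)
Definition r_distance (p : X -> X -> \bar R) : Prop :=
  [/\ forall x y, (0 <= p x y)%E,
      forall x y z, (p x z <= p x y + p y z)%E,
      forall y : nat -> X,
        (forall delta : R, 0 < delta -> exists N : nat,
           forall n m : nat, (N <= n < m)%N -> (p (y n) (y m) < delta%:E)%E) ->
        cauchy (y n @[n --> \oo])
    & forall x y z, p z x = 0%E -> p z y = 0%E -> x = y].

End RDistance.

Definition dynamically_closed (X : topologicalType) (S : X -> set X) (x : X) :
    Prop :=
  forall (u : nat -> X) (l : X),
    (forall n, S x (u n)) ->
    (forall n, S (u n.+1) `<=` S (u n) /\ S (u n) `<=` S x) ->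
    u n @[n --> \oo] --> l -> S x l.

Section Cones.
Context {R : realType} {Y : tvsType R}.

Definition convex_cone (D : set Y) : Prop :=
  [/\ D !=set0, D `(+)` D `<=` D & forall a : R, 0 <= a -> a `*:` D `<=` D].

Definition nontrivial_cone (D : set Y) : Prop := D <> [set 0] /\ D <> setT.

Definition topological_dual : set {linear Y -> R^o} :=
  [set l : {linear Y -> R^o} | continuous l].

(* The set D^+ *)
Definition positive_dual (D : set Y) : set {linear Y -> R^o} :=
  [set l | topological_dual l /\ forall d, D d -> 0 <= (l d : R)].

(* The set H^{+s}. The infimum is taken in the extended reals, so it is +oo
   when H is empty. *)
Definition strict_positive_dual (H : set Y) : set {linear Y -> R^o} :=
  [set l | topological_dual l /\
           (0 < ereal_inf [set (l h : R)%:E | h in H])%E].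

Definition lower_bounded_on (xi : Y -> R) (M : set Y) : Prop :=
  (-oo < ereal_inf [set (xi y)%:E | y in M])%E.

Definition strict_minimizer (X : Type) (D : set Y) (G : X -> set Y)
    (xhat : X) : Prop :=
  forall x, x <> xhat -> ~ (G xhat `<=` G x `(+)` D).

(* The set S(x) *)
Definition sublevel (X : Type) (D H : set Y) (f : X -> set Y)
    (p : X -> X -> R) (x : X) : set X :=
  [set z | f x `<=` f z `(+)` p x z `*:` H `(+)` D].

End Cones.

(* Main.v *)
(* Since [H] is convex and [D] is a convex cone, [S] is transitive, and
   [phi x := inf (xi (f x))] satisfies [phi z + c p(x, z) <= phi x] for
   [z \in S(x)], where [c > 0] bounds [xi] from below on [H].  A point of [S(x0)]
   with empty [S] is a solution; if there is none, choose [x_(n+1)] in [S(x_n)]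
   nearly minimizing [phi].  The sequence is Cauchy by (q2) and its limit [l]
   lies in every [S(x_n)].  On [S(l)] the function [phi] is constantly [phi l],
   so [p(l, _)] vanishes there and [S(l)] has a unique point by (q3), which is
   the solution by transitivity.
   The equivalence in (B1) is the separation of [0] from the convex set [H + D],
   obtained from the Hahn-Banach theorem in the form: a minimal sublinear
   functional is linear. *)
Require Import Defs.
From HB Require Import structures.
From mathcomp Require Import all_boot all_order all_algebra.
From mathcomp Require Import all_classical all_reals all_analysis.
From mathcomp Require Import lra.

Set Implicit Arguments.
Unset Strict Implicit.
Unset Printing Implicit Defensive.

Import Order.TTheory GRing.Theory Num.Theory.
Import numFieldNormedType.Exports.

Local Open Scope classical_set_scope.
Local Open Scope ring_scope.

(** * Sublinear functionals and the Hahn-Banach theorem *)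

Section HahnBanach.
Context {R : realType} {E : lmodType R}.
Implicit Types (q : E -> R) (x y : E).

(** Homogeneity is asked only as an inequality for [s > 0], which is easy to check on infima;
    equality follows by applying it to [s^-1] as well. *)
Definition sublinear q :=
  (forall x y, q (x + y) <= q x + q y) /\
  (forall s x, 0 < s -> q (s *: x) <= s * q x).

Lemma sublinear0 q : sublinear q -> q 0 = 0.
Proof.
move=> [_ qZ]; have := qZ 2 0 (ltr0n _ _); have := qZ (2^-1) 0.
rewrite !scaler0 invr_gt0 ltr0n => /(_ isT); lra.
Qed.

Lemma sublinearN q x : sublinear q -> - q (- x) <= q x.
Proof.
move=> subq; have [qD _] := subq.
by have := qD x (- x); rewrite subrr (sublinear0 subq); lra.
Qed.

Lemma sublinearZ q s x : sublinear q -> 0 <= s -> q (s *: x) = s * q x.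
Proof.
move=> subq; have [_ qZ] := subq.
rewrite le_eqVlt => /predU1P[<-|s0].
  by rewrite scale0r mul0r sublinear0.
apply/eqP; rewrite eq_le qZ//= -ler_pdivlMl//.
by rewrite -[in leLHS](scalerK (lt0r_neq0 s0) x) qZ// invr_gt0.
Qed.

(** Common pattern for three infima: over a chain of functionals, in the proof of additivity, and in
    the separation of [0] from a convex set. *)
Lemma inf_sublinear (A : E -> set R) :
  (forall x, has_inf (A x)) ->
  (forall x y a b, A x a -> A y b -> exists2 c, A (x + y) c & c <= a + b) ->
  (forall s x a, 0 < s -> A x a -> exists2 c, A (s *: x) c & c <= s * a) ->
  sublinear (fun x => inf (A x)).
Proof.
move=> infA AD AZ; split=> [x y|s x s0].
  rewrite -lerBlDr; apply: lb_le_inf; first exact: (infA x).1.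
  move=> a Aa; rewrite lerBlDr -lerBlDl.
  apply: lb_le_inf; first exact: (infA y).1.
  move=> b Ab; rewrite lerBlDl; have [c Ac /(le_trans _)] := AD _ _ _ _ Aa Ab.
  by apply; apply: ge_inf => //; exact: (infA _).2.
rewrite -ler_pdivrMl//; apply: lb_le_inf; first exact: (infA x).1.
move=> a Aa; rewrite ler_pdivrMl//; have [c Ac /(le_trans _)] := AZ _ _ _ s0 Aa.
by apply; apply: ge_inf => //; exact: (infA _).2.
Qed.

(** Zorn's lemma for the reversed pointwise order. A nonempty chain is bounded by its pointwise
    infimum, which is finite because every member is at least [- q (- x)] at [x]. *)
Lemma minimal_sublinear q : sublinear q ->
  exists r, [/\ sublinear r, forall x, r x <= q x &
    forall r', sublinear r' -> (forall x, r' x <= r x) -> r' = r].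
Proof.
move=> subq.
pose T := {r | sublinear r /\ forall x, r x <= q x}.
pose le (r s : T) := `[< forall x, sval s x <= sval r x >].
have [||[r pr] [s ps] /asboolP/= rs /asboolP/= sr|A totA|[r [subr rq]] minr]
  := @Zorn T le.
- by move=> r; apply/asboolP.
- move=> r s t /asboolP rs /asboolP st; apply/asboolP => x.
  exact: le_trans (st x) (rs x).
- by apply: eq_exist; apply/funext => x; apply/le_anti; rewrite sr rs.
- have [[a Aa]|A0] := pselect (A !=set0); last first.
    exists (exist _ q (conj subq (fun x => lexx _))) => s As.
    by exfalso; apply: A0; exists s.
  pose B x := [set sval s x | s in A].
  have infB x : has_inf (B x).
    split; first by exists (sval a x), a.
    exists (- q (- x)) => _ [s As <-]; case: s {As} => s [subs sq] /=.
    by apply: le_trans (sublinearN x subs); rewrite lerN2.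
  have subB : sublinear (fun x => inf (B x)).
    apply: inf_sublinear => [//|x y _ _ [s As <-] [t At <-]|c x _ c0 [s As <-]].
      (* The smaller of the two functionals bounds both values at once. *)
      have [/asboolP st|/asboolP ts] := totA s t As At.
        exists (sval t (x + y)); first by exists t.
        by apply: le_trans ((svalP t).1.1 _ _) _; rewrite lerD2r.
      exists (sval s (x + y)); first by exists s.
      by apply: le_trans ((svalP s).1.1 _ _) _; rewrite lerD2l.
    by exists (sval s (c *: x)); [exists s|exact: (svalP s).1.2].
  have Bs s x : A s -> inf (B x) <= sval s x.
    by move=> As; apply: ge_inf; [exact: (infB x).2|exists s].
  unshelve eexists (exist _ (fun x => inf (B x)) (conj subB _)).
    by move=> x; apply: le_trans (Bs _ x Aa) ((svalP a).2 x).
  by move=> s As; apply/asboolP => x; exact: Bs.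
- exists r; split=> // r' subr' r'r.
  have r'q x : r' x <= q x by exact: le_trans (r'r x) (rq x).
  by have /(_ (asboolT r'r)) [] := minr (exist _ r' (conj subr' r'q)).
Qed.

(* Minimality of [q] is applied to [x |-> inf_(t >= 0) (q (x + t y) - t q y)]. *)
Lemma minimal_sublinearD q : sublinear q ->
  (forall r, sublinear r -> (forall x, r x <= q x) -> r = q) ->
  {morph q : x y / x + y}.
Proof.
move=> subq minq x y; have [qD _] := subq.
pose A x := [set q (x + t *: y) - t * q y | t in [set t | 0 <= t]].
have infA z : has_inf (A z).
  split; first by exists (q (z + 0 *: y) - 0 * q y); exists 0 => /=.
  exists (- q (- z)) => _ [t /= t0 <-]; rewrite -sublinearZ//.
  have := qD (z + t *: y) (- z); rewrite addrAC subrr add0r; lra.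
have subA : sublinear (fun x => inf (A x)).
  apply: inf_sublinear =>
    [//|u v _ _ [s /= s0 <-] [t /= t0 <-]|c u _ c0 [t /= t0 <-]].
    exists (q (u + v + (s + t) *: y) - (s + t) * q y).
      by exists (s + t) => //=; exact: addr_ge0.
    have := qD (u + s *: y) (v + t *: y).
    rewrite addrACA -scalerDl; lra.
  exists (q (c *: u + (c * t) *: y) - c * t * q y).
    by exists (c * t) => //=; rewrite mulr_ge0// ltW.
  by rewrite mulrBr mulrA lerD2r -scalerA -scalerDr sublinearZ// ltW.
have Aq z t : 0 <= t -> inf (A z) <= q (z + t *: y) - t * q y.
  by move=> t0; apply: ge_inf; [exact: (infA z).2|exists t].
have AE : (fun x => inf (A x)) = q.
  apply: minq => // z; have := Aq z 0 (lexx 0).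
  by rewrite scale0r mul0r addr0 subr0.
(* The parameter [t = 1] gives [q x <= q (x + y) - q y], the converse of subadditivity. *)
have := Aq x 1 ler01; rewrite (congr1 (@^~ x) AE) scale1r mul1r.
by move=> qxy; apply/le_anti/andP; split; [exact: qD|lra].
Qed.

Theorem hahn_banach q : sublinear q ->
  exists l : {linear E -> R^o}, forall x, l x <= q x.
Proof.
move=> /minimal_sublinear[r [subr rq minr]].
have rD := minimal_sublinearD subr minr.
have rN x : r (- x) = - r x.
  by have := rD x (- x); rewrite subrr (sublinear0 subr); lra.
have rZ c x : r (c *: x) = c * r x.
  have [c0|c0] := leP 0 c; first exact: sublinearZ.
  rewrite -[c]opprK scaleNr rN sublinearZ ?mulNr// oppr_ge0; exact: ltW.
have r_lin : linear_for *:%R (r : E -> R^o).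
  by move=> c x y; rewrite rD rZ.
pose rL := GRing.isLinear.Build R E R^o *:%R r r_lin.
pose l : {linear E -> R^o} := HB.pack (r : E -> R^o) rL.
by exists l.
Qed.

End HahnBanach.

(** * Convex sets and convex cones *)

Section ConvexSets.
Context {R : realType} {E : lmodType R}.
Implicit Types (A B : set E).

(** The weights are [a / (a + b)] and [b / (a + b)]; if [a + b = 0], any point of [A] serves as
    [z]. *)
Lemma convex_set_comb A (a b : R) x y : convex_set A -> 0 <= a -> 0 <= b ->
  A x -> A y -> exists2 z, A z & a *: x + b *: y = (a + b) *: z.
Proof.
move=> convA a0 b0 Ax Ay.
have := addr_ge0 a0 b0; rewrite le_eqVlt => /predU1P[/esym/eqP|ab0].
  rewrite paddr_eq0// => /andP[/eqP-> /eqP->]; exists x => //.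
  by rewrite addr0 !scale0r addr0.
have l0 : 0 <= a / (a + b) by rewrite divr_ge0// ltW.
have l1 : a / (a + b) <= 1 by rewrite ler_pdivrMr// mul1r lerDl.
have := convA x y (Itv01 l0 l1); rewrite !inE => /(_ Ax Ay) Az.
eexists; first exact: Az.
have ab_neq0 := lt0r_neq0 ab0.
rewrite /conv/= scalerDr !scalerA mulrC divfK// mulrBr mulr1.
by rewrite [_ * (a / _)]mulrC divfK// addrAC subrr add0r.
Qed.

Lemma convex_set_minkowski A B :
  convex_set A -> convex_set B -> convex_set (A `(+)` B).
Proof.
move=> convA convB x y l; rewrite !inE.
move=> [a Aa [b Bb <-]] [a' Aa' [b' Bb' <-]].
have := convA a a' l; rewrite !inE => /(_ Aa Aa') Ac.
have := convB b b' l; rewrite !inE => /(_ Bb Bb') Bc.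
eexists; first exact: Ac; eexists; first exact: Bc.
by rewrite /conv/= !scalerDr addrACA.
Qed.

End ConvexSets.

Section ConvexCones.
Context {R : realType} {Y : tvsType R} (D : set Y).
Hypothesis coneD : convex_cone D.

Lemma convex_coneZ (a : R) d : 0 <= a -> D d -> D (a *: d).
Proof. by case: coneD => _ _ DZ a0 Dd; apply: DZ a0 _ _; exists d. Qed.

Lemma convex_coneD c d : D c -> D d -> D (c + d).
Proof. by case: coneD => _ DD _ Dc Dd; apply: DD; exists c => //; exists d. Qed.

Lemma convex_cone0 : D 0.
Proof.
by have [[d Dd] _ _] := coneD; rewrite -(scale0r d); exact: convex_coneZ.
Qed.

Lemma convex_cone_convex : convex_set D.
Proof.
move=> x y l; rewrite !inE => Dx Dy.
by apply: convex_coneD; apply: convex_coneZ => //; rewrite subr_ge0.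
Qed.

End ConvexCones.

(** * Separation of [0] from a convex set *)

Section Separation.
Context {R : realType} {E : tvsType R}.
Implicit Types (V K : set E) (l : {linear E -> R^o}).

(** By continuity of scaling at [(0, x)], [t *: x] lies in [V] for small [t > 0]; then
    [s = t^-1]. *)
Lemma nbhs0_absorbing V x : nbhs 0 V ->
  exists2 s : R, 0 < s & exists2 v, V v & x = s *: v.
Proof.
move=> V0.
have := @scale_continuous R E (0, x) V.
rewrite /= scale0r => /(_ V0)[B [B1 B2] BV].
have [t [Vt t0]] : exists t : R, V (t *: x) /\ 0 < t.
  near (0 : R)^'+ => t; exists t; split; last by near: t; exact: nbhs_right_gt.
  apply: (BV (t, x)); split; last exact: nbhs_singleton.
  by near: t; exact: (@cvg_within _ (nbhs (0 : R))).
exists t^-1; first by rewrite invr_gt0.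
by exists (t *: x) => //; rewrite scalerK// lt0r_neq0.
Unshelve. all: by end_near. Qed.

(** A one-sided bound suffices: on [x + (e / 2) V] it bounds [l y - l x] above by [e / 2], on
    [x - (e / 2) V] below by [- e / 2]. *)
Lemma linear_bounded_above_continuous V l : nbhs 0 V ->
  (forall v, V v -> l v <= 1) -> continuous l.
Proof.
move=> V0 l1 x; apply/cvgrPdist_lt => e e0.
have e2 : e / 2 != 0 by rewrite lt0r_neq0// divr_gt0.
have Ve := nbhsT x (nbhs0Z e2 V0).
have VNe : nbhs x _ := nbhsT x (nbhs0Z (_ : - (e / 2) != 0) V0).
rewrite oppr_eq0 in VNe; near=> y.
have [_ [v Vv <-] vE] : (+%R x @` ( *:%R (e / 2) @` V)) y by near: y.
have [_ [w Vw <-] wE] : (+%R x @` ( *:%R (- (e / 2)) @` V)) y.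
  by near: y; exact: VNe.
have lv : l y = l x + e / 2 * l v by rewrite -vE linearD linearZ.
have lw : l y = l x - e / 2 * l w by rewrite -wE linearD linearZ/= scaleNr.
have := l1 _ Vv; have := l1 _ Vw; rewrite ltr_norml => {}lw1 {}lv1.
have ev : e / 2 * l v <= e / 2 by rewrite ler_piMr// ltW// divr_gt0.
have ew : e / 2 * l w <= e / 2 by rewrite ler_piMr// ltW// divr_gt0.
by apply/andP; split; lra.
Unshelve. all: by end_near. Qed.

(* The dominating functional is the smallest sublinear one that is at most the
   gauge of [V] and at most [-1] on [-K]. *)
Theorem convex_separation0 K : convex_set K -> K !=set0 -> ~ closure K 0 ->
  exists2 l : {linear E -> R^o}, continuous l & forall k, K k -> 1 <= l k.
Proof.
move=> convK [k0 Kk0] /existsNP[B /not_implyP[B0 KB]].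
have [Bs Bs_conv [Bs_open Bs_basis]] := @locally_convex R E.
have [V [BsV V0] VB] := Bs_basis 0 B B0.
have convV : convex_set V by apply: Bs_conv; rewrite inE.
have nV : nbhs 0 V by apply: open_nbhs_nbhs; split => //; exact: Bs_open.
have KV k : K k -> V k -> False by move=> Kk /VB Bk; apply: KB; exists k.
pose A x := [set a : R | exists t s k v,
  [/\ 0 < t, 0 <= s, K k, V v & x + s *: k = t *: v /\ a = t - s]].
have Alb x : has_inf (A x).
  split.
    have [s s0 [v Vv ->]] := nbhs0_absorbing x nV.
    by exists s; exists s, 0, k0, v; rewrite scale0r addr0 subr0.
  (* With [- x = r *: w], the number [- r] is a lower bound: if [t - s < - r], then
     [s *: k = t *: v + r *: w] is [t + r] times a point of [V], and [t + r < s] puts [k] in [V],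
     which misses [K]. *)
  have [r r0 [w Vw xE]] := nbhs0_absorbing (- x) nV.
  exists (- r) => _ [t [s [k [v [t0 s0 Kk Vv [xk ->]]]]]].
  rewrite leNgt; apply/negP => tsr.
  have {}s0 : 0 < s by lra.
  have [u Vu uE] := convex_set_comb convV (ltW t0) (ltW r0) Vv Vw.
  have skE : s *: k = (t + r) *: u by rewrite -uE -xk -xE addrAC subrr add0r.
  have c0 : 0 <= (t + r) / s by rewrite divr_ge0// ltW// addr_gt0.
  have c1 : 0 <= 1 - (t + r) / s by rewrite subr_ge0 ler_pdivrMr//; lra.
  have [z Vz] := convex_set_comb convV c0 c1 Vu V0.
  rewrite scaler0 addr0 [_ + (1 - _)]addrC subrK scale1r mulrC -scalerA -skE.
  by rewrite scalerK ?lt0r_neq0// => kz; apply: (KV k) => //; rewrite kz.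
have subA : sublinear (fun x => inf (A x)).
  apply: inf_sublinear => [//|x y a b|c x a c0].
    move=> [t [s [k [v [t0 s0 Kk Vv [xk ->]]]]]].
    move=> [t' [s' [k' [v' [t'0 s'0 Kk' Vv' [yk ->]]]]]].
    exists (t + t' - (s + s')); last by lra.
    have [k'' Kk'' kE] := convex_set_comb convK s0 s'0 Kk Kk'.
    have [v'' Vv'' vE] := convex_set_comb convV (ltW t0) (ltW t'0) Vv Vv'.
    exists (t + t'), (s + s'), k'', v''.
    split=> //; rewrite ?addr_gt0 ?addr_ge0//.
    by rewrite -kE -vE -xk -yk addrACA.
  move=> [t [s [k [v [t0 s0 Kk Vv [xk ->]]]]]].
  exists (c * (t - s)) => //; exists (c * t), (c * s), k, v.
  split=> //; rewrite ?mulr_gt0 ?mulr_ge0 ?(ltW c0)//.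
  by rewrite -!scalerA -scalerDr xk mulrBr.
have [l lA] := hahn_banach subA; exists l.
  apply: (linear_bounded_above_continuous nV) => v Vv.
  apply: le_trans (lA v) _; apply: ge_inf; first exact: (Alb v).2.
  by exists 1, 0, k0, v; rewrite scale0r addr0 scale1r subr0.
(* At [- k] the set [A] contains [e - 1] for each [e > 0] but, [t] being positive, the value [-1] is
   reached only in the limit. *)
move=> k Kk; rewrite -lerN2 -linearN; apply/ler_addgt0Pr => e e0.
apply: le_trans (lA _) _; apply: ge_inf; first exact: (Alb _).2.
by exists e, 1, k, 0; rewrite scale1r addNr scaler0 addrC.
Qed.

End Separation.

(** Trades an extended infimum for a real bound: [a = 0] serves for [xi] on [H], [a = -oo] for [xi]
    on the values of [f]. An infimum [+oo], as for empty [M], leaves any real above [a]. *)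
Lemma lt_ereal_inf_lbound {R : realType} {T : Type} (g : T -> R) (M : set T)
    (a : \bar R) : (a < ereal_inf [set (g y)%:E | y in M])%E ->
  exists2 c : R, (a < c%:E)%E & forall y, M y -> c <= g y.
Proof.
move=> aM; have [c ac cM] : exists2 c : R, (a < c%:E)%E &
    (c%:E <= ereal_inf [set (g y)%:E | y in M])%E.
  move: aM; case: ereal_inf => [r ar||].
  - by exists r.
  - case: a => [r _||]; [|by []|].
    + by exists (r + 1); rewrite ?leey// lte_fin ltrDl.
    + by move=> _; exists 0; rewrite ?leey// ltNyr.
  - by rewrite ltNge leNye.
exists c => // y My; rewrite -lee_fin; apply: le_trans cM _.
by apply: ereal_inf_lbound; exists y.
Qed.

(** * Minimal points of a transitive set-valued map *)

Section MinimalPoint.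
Context {R : realType} {X : uniformType}.
Variables (p : X -> X -> R) (S : X -> set X) (phi : X -> R) (M : set X).
Variables (c m : R).
Hypothesis complX : sequentially_complete X.
Hypothesis rdist_p : r_distance (fun x y => (p x y)%:E).
Hypothesis S_trans : forall x z, S x z -> S z `<=` S x.
Hypothesis M_neq0 : M !=set0.
Hypothesis SM : forall x, M x -> S x `<=` M.
Hypothesis dynS : forall x, M x -> dynamically_closed S x.
Hypothesis phi_ge : forall x, M x -> m <= phi x.
Hypothesis c0 : 0 < c.
Hypothesis phiS : forall x z, M x -> S x z -> phi z + c * p x z <= phi x.

Let nearly_minimal (n : nat) x z :=
  S x z /\ forall w, S x w -> phi z <= phi w + n.+1%:R^-1.

Let exists_nearly_minimal n x : M x -> S x !=set0 ->
  exists z, nearly_minimal n x z.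
Proof.
move=> Mx [z Sxz].
have infS : has_inf (phi @` S x).
  split; first by exists (phi z), z.
  by exists m => _ [w /(SM Mx) Mw <-]; exact: phi_ge.
have n0 : 0 < n.+1%:R^-1 :> R by rewrite invr_gt0.
have [_ [w Sxw <-] wz] := inf_adherent n0 infS.
exists w; split=> // v Sxv; apply: le_trans (ltW wz) _; rewrite lerD2r.
by apply: ge_inf; [exact: infS.2|exists v].
Qed.

(** The conclusion leaves open whether [xhat] is in [S xhat], since [p x x] may be positive. *)
Lemma minimal_point : exists2 xhat, M xhat & forall x, S xhat x -> x = xhat.
Proof.
have [[x [Mx Sx0]]|noempty] := pselect (exists x, M x /\ ~ (S x !=set0)).
  by exists x => // z Sxz; exfalso; apply: Sx0; exists z.
have S_neq0 x : M x -> S x !=set0.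
  by move=> Mx; apply: contrapT => Sx0; apply: noempty; exists x.
have [p_ge0 _ p_cauchy p_eq0] := rdist_p.
(* Guarding by [M] makes [g] total; its values outside [M] are arbitrary. *)
have /choice[g gP] (nx : nat * X) :
    exists z, M nx.2 -> nearly_minimal nx.1 nx.2 z.
  case: nx => n x /=; have [Mx|nMx] := pselect (M x); last by exists x.
  by have [z] := exists_nearly_minimal n Mx (S_neq0 _ Mx); exists z.
have [x1 Mx1] := M_neq0.
pose u := nat_rect (fun=> X) x1 (fun n x => g (n, x)).
have Mu n : M (u n).
  by elim: n => //= n Mun; apply: (SM Mun); exact: (gP (n, u n) Mun).1.
have Su n : S (u n) (u n.+1) by exact: (gP (n, u n) (Mu n)).1.
have u_min n w : S (u n) w -> phi (u n.+1) <= phi w + n.+1%:R^-1.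
  exact: (gP (n, u n) (Mu n)).2.
have Su_lt n k : (n < k)%N -> S (u n) (u k).
  elim: k => // k IHk; rewrite ltnS leq_eqVlt => /predU1P[->|/IHk Snk].
    exact: Su.
  exact: S_trans Snk _ (Su k).
have /complX[l ul] : cauchy (u n @[n --> \oo]).
  apply: p_cauchy => delta delta0.
  have [K Kdelta] : exists K : nat, 0 + K.+1%:R^-1 < c * delta.
    by apply: ltr_add_invr; exact: mulr_gt0.
  (* The threshold [K.+1] makes the first index a successor [n.+1]. As [u k] is in [S (u n)], near
     minimality gives [c * p (u n.+1) (u k) <= phi (u n.+1) - phi (u k) <= n.+1%:R^-1]. *)
  exists K.+1 => -[//|n] k /andP[Kn nk].
  rewrite lte_fin -(ltr_pM2l c0); apply: le_lt_trans Kdelta; rewrite add0r.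
  have := phiS (Mu _) (Su_lt _ _ nk).
  have := u_min n _ (Su_lt _ _ (ltnW nk)).
  have : n.+1%:R^-1 <= K.+1%:R^-1 :> R by rewrite lef_pV2 ?posrE// ler_nat.
  by move: (n.+1%:R^-1) (K.+1%:R^-1) => a b; lra.
have Sul n : S (u n) l.
  (* The tail starts at [n.+1] because [u n] itself need not belong to [S (u n)]. *)
  apply: (dynS (Mu n) (u := fun k => u (k + n.+1)%N)).
  - by move=> k; apply: Su_lt; rewrite addnS ltnS leq_addl.
  - move=> k; split; apply: S_trans; first exact: Su.
    by apply: Su_lt; rewrite addnS ltnS leq_addl.
  - exact: cvg_comp (cvg_addnr n.+1) ul.
have Ml : M l by exact: SM (Mu 0) _ (Sul 0).
have p_eq0_l z : S l z -> p l z = 0.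
  move=> Slz; have phi_lz : phi l <= phi z.
    (* Since [l] is in [S (u n.+1)] and [z] in [S (u n)], [phi l <= phi (u n.+1) <= phi z +
       n.+1%:R^-1]. *)
    apply/ler_addgt0Pr => e /ltr_add_invr[n]; rewrite add0r => ne.
    have := u_min n _ (S_trans (Sul n) Slz).
    have := phiS (Mu n.+1) (Sul n.+1).
    have := p_ge0 (u n.+1) l; rewrite lee_fin => /(mulr_ge0 (ltW c0)).
    by move: (n.+1%:R^-1) ne => a; lra.
  have := p_ge0 l z; rewrite lee_fin => plz.
  apply/le_anti; rewrite plz andbT -(pmulr_rle0 _ c0).
  by have := phiS Ml Slz; lra.
have [z Slz] := S_neq0 _ Ml; exists z; first exact: SM Ml _ Slz.
move=> x /(S_trans Slz) Slx.
by apply: (p_eq0 _ _ l); rewrite p_eq0_l.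
Qed.

End MinimalPoint.

(** * The two forms of (B1) *)

Section StrictPositiveDual.
Context {R : realType} {Y : tvsType R} (D H : set Y).
Hypotheses (coneD : convex_cone D) (convH : convex_set H).

(** If [xi >= c > 0] on [H + D], the neighbourhood [xi < c] of [0] misses [H + D]. Conversely, a
    functional separating [0] from [H + D] is at least [1] on [H], and nonnegative on the cone
    [D]. *)
Lemma strict_positive_dual_neq0P :
  strict_positive_dual H `&` positive_dual D !=set0 <->
  ~ closure (H `(+)` D) 0.
Proof.
split=> [[xi [[xi_cont /lt_ereal_inf_lbound[c c0 cH]] [_ D_ge0]]] clHD|HD].
  have : nbhs (0 : Y) [set y | xi y < c].
    have xi0 : xi y @[y --> (0 : Y)] --> (0 : R).
      by have := xi_cont 0; rewrite /continuous_at linear0.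
    exact: cvgr_lt xi0 _ c0.
  move=> /clHD[_ [[h Hh [d Dd <-]]]] /=.
  by rewrite linearD ltNge; apply/negP/negPn; rewrite ler_wpDr ?D_ge0 ?cH.
(* For empty [H] the zero functional qualifies, its infimum over [H] being [+oo]. *)
have [[h0 Hh0]|/set0P/negP/negPn/eqP H0] := pselect (H !=set0); last first.
  exists \0; split; split.
  - exact: cst_continuous.
  - by rewrite H0 image_set0 ereal_inf0 ltry.
  - exact: cst_continuous.
  - by [].
have D0 := convex_cone0 coneD.
have convHD := convex_set_minkowski convH (convex_cone_convex coneD).
have HDh0 : H `(+)` D !=set0 by exists (h0 + 0), h0 => //; exists 0.
have [xi xi_cont xi_ge1] := convex_separation0 convHD HDh0 HD.
exists xi; split; split=> //.
  apply: (@lt_le_trans _ _ 1%:E) => //; apply: le_ereal_inf_tmp => _ [h Hh <-].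
  by rewrite lee_fin -[h]addr0 xi_ge1//; exists h => //; exists 0.
move=> d Dd; rewrite leNgt; apply/negP => xid.
(* This [t] makes [xi] vanish at [h0 + t *: d], a point of [H + D] where [xi] is at least [1]. *)
pose t : R := - xi h0 / xi d.
have xih0 : 1 <= xi h0.
  by rewrite -[h0]addr0 xi_ge1//; exists h0 => //; exists 0.
have t0 : 0 <= t by rewrite /t mulNr -mulrN -invrN divr_ge0//; lra.
have : 1 <= xi (h0 + t *: d).
  apply: xi_ge1; exists h0 => //; exists (t *: d) => //.
  exact: convex_coneZ.
rewrite linearD linearZ/= /t /GRing.scale/= divfK ?ltr0_neq0//.
by rewrite subrr ler10.
Qed.

End StrictPositiveDual.

(** * Transitivity of [S] and decrease of the infimum of [xi] *)

Section Sublevel.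
Context {R : realType} {Y : tvsType R} {X : Type} (D H : set Y).
Variables (f : X -> set Y) (p : X -> X -> R).
Hypotheses (coneD : convex_cone D) (HD : H `<=` D) (convH : convex_set H).
Hypothesis p_ge0 : forall x y, 0 <= p x y.
Hypothesis p_triangle : forall x y z, p x z <= p x y + p y z.

Lemma sublevelP x z y : sublevel D H f p x z -> f x y ->
  exists y' h d, [/\ f z y', H h, D d & y = y' + p x z *: h + d].
Proof.
by move=> Sxz /Sxz[_ [y' fy' [_ [h Hh <-] <-]] [d Dd <-]]; exists y', h, d.
Qed.

(** Convexity of [H] merges [p x z *: h1 + p z w *: h2] into [(p x z + p z w) *: h]. By the triangle
    inequality the excess over [p x w *: h] is a nonnegative multiple of [h], absorbed by [D]. *)
Lemma sublevel_trans x z : sublevel D H f p x z ->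
  sublevel D H f p z `<=` sublevel D H f p x.
Proof.
move=> Sxz w Szw y /(sublevelP Sxz)[y1 [h1 [d1 [fy1 Hh1 Dd1 ->]]]].
have [y2 [h2 [d2 [fy2 Hh2 Dd2 ->]]]] := sublevelP Szw fy1.
have [h Hh hE] := convex_set_comb convH (p_ge0 x z) (p_ge0 z w) Hh1 Hh2.
exists (y2 + p x w *: h).
  by exists y2 => //; exists (p x w *: h) => //; exists h.
exists ((p x z + p z w - p x w) *: h + (d1 + d2)).
  apply: convex_coneD => //; last exact: convex_coneD.
  by apply: convex_coneZ => //; [rewrite subr_ge0|exact: HD].
rewrite scalerBl -hE -addrA [p x w *: h + _]addrA [p x w *: h + _]addrC subrK.
by rewrite addrACA [_ + d1 + _]addrC !addrA.
Qed.

Lemma sublevel_inf (xi : {linear Y -> R^o}) (c : R) x z :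
  (forall h, H h -> c <= xi h) -> (forall d, D d -> 0 <= (xi d : R)) ->
  f x !=set0 -> has_lbound (xi @` f z) -> sublevel D H f p x z ->
  inf (xi @` f z) + c * p x z <= inf (xi @` f x).
Proof.
move=> cH D_ge0 [y0 fxy0] xi_lb Sxz; apply: lb_le_inf.
  by exists (xi y0), y0.
move=> _ [y /(sublevelP Sxz)[y' [h [d [fy' Hh Dd ->]]]] <-].
rewrite !linearD linearZ/= -[leLHS]addr0; apply: lerD (D_ge0 _ Dd).
apply: lerD; first by apply: ge_inf => //; exists y'.
by rewrite mulrC ler_wpM2l// cH.
Qed.

End Sublevel.

Theorem theorem4p1 (R : realType)
    (X : uniformType) (hausX : hausdorff_space X)
    (complX : sequentially_complete X)
    (Y : tvsType R) (hausY : hausdorff_space Y)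
    (D : set Y) (coneD : convex_cone D) (nontrivD : nontrivial_cone D)
    (H : set Y) (H_sub : H `<=` D `\ 0) (convH : convex_set H)
    (f : X -> set Y) (f_neq0 : forall x, f x !=set0)
    (p : X -> X -> R) (rdist_p : r_distance (fun x y => (p x y)%:E))
    (S := sublevel D H f p)
    (x0 : X) (Sx0_neq0 : S x0 !=set0)
    (dynS : forall x, S x0 x -> dynamically_closed S x) :
  (strict_positive_dual H `&` positive_dual D !=set0 <->
     ~ closure (H `(+)` D) 0) /\
  (strict_positive_dual H `&` positive_dual D !=set0 ->
   (exists2 xi : {linear Y -> R^o},
      (strict_positive_dual H `&` positive_dual D) xi
    & lower_bounded_on xi (\bigcup_(x in S x0) f x)) ->
   exists xhat : X,
     [/\ f x0 `<=` f xhat `(+)` p x0 xhat `*:` H `(+)` D,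
         forall x, x <> xhat ->
           ~ (f xhat `<=` f x `(+)` p xhat x `*:` H `(+)` D)
       & (forall x, p x x = 0) ->
           strict_minimizer D (fun x => f x `(+)` p xhat x `*:` H) xhat]).
Proof.
split; first exact: strict_positive_dual_neq0P.
move=> _ [xi [[_ /lt_ereal_inf_lbound[c c0 cH]] [_ D_ge0]]].
move=> /lt_ereal_inf_lbound[m _ m_le].
have HD : H `<=` D by move=> h /H_sub[].
have p_ge0 x y : 0 <= p x y by case: rdist_p => + _ _ _; exact.
have p_triangle x y z : p x z <= p x y + p y z.
  by case: rdist_p => _ + _ _; apply.
have S_trans := sublevel_trans (f := f) coneD HD convH p_ge0 p_triangle.
have m_lb x : S x0 x -> lbound (xi @` f x) m.
  by move=> Sx _ [y fxy <-]; apply: m_le; exists x.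
have [x Sx|x z Sx Sxz|xhat Sxhat xhatP] :=
  @minimal_point R X p S (fun x => inf (xi @` f x)) (S x0) c m complX rdist_p
    S_trans Sx0_neq0 (S_trans x0) dynS _ c0 _.
- apply: lb_le_inf; last exact: m_lb.
  by have [y fxy] := f_neq0 x; exists (xi y), y.
- apply: (sublevel_inf p_ge0 cH D_ge0 (f_neq0 x) _ Sxz).
  by exists m; apply: m_lb; exact: (S_trans _ _ Sx).
exists xhat.
have xhat_min x : x <> xhat ->
    ~ (f xhat `<=` f x `(+)` p xhat x `*:` H `(+)` D).
  by move=> x_neq Sx; exact/x_neq/xhatP.
split=> // pxx x /xhat_min + fxhat; apply => y fy; apply: fxhat.
(* To view [y] as a point of [f xhat + 0 H], some [h] in [H] is needed; the inclusion defining
   [S x0 xhat] supplies one at any point of [f x0]. *)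
have [y0 fy0] := f_neq0 x0; have [_ [h [_ [_ Hh _ _]]]] := sublevelP Sxhat fy0.
by exists y => //; exists 0; [exists h; rewrite // pxx scale0r|rewrite addr0].
Qed.
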